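(* Let $B$ be a local ring (not necessarily commutative or finite) with $2\in B^\times$ and with an involution $*$, let $m\geq 1$, $A=M(m,B)$ and $\varepsilon\in\{1,-1\}$. Then $\mathrm{SL}^{\varepsilon}_*(2,A)=\mathrm{SSL}^{\varepsilon}_*(2,A)$, except when $\varepsilon=1$, $*$ is ramified and $m$ is even. In this exceptional case $\mathrm{SL}^{\varepsilon}_*(2,A)=\mathrm{SSL}^{\varepsilon}_*(2,A)\rtimes\langle T\rangle$, and $\mathrm{SSL}^{\varepsilon}_*(2,A)$ is the $\Omega$-preimage of the special orthogonal group $\mathrm{SO}_{2m}(\mathbb{F})$.
   Context: All rings have an identity $1\neq 0$; $B^\times$ is the unit group of $B$. An involution is an antiautomorphism of order 1 or 2. Extend $*$ to $A=M(m,B)$ by $(x^* )_{ij}=(x_{ji})^*$. The group $\mathrm{SL}^{\varepsilon}_*(2,A)$ consists of all $\begin{pmatrix} a&b\\ c&d\end{pmatrix}\in\mathrm{GL}(2,A)$ with $a^*c=-\varepsilon c^*a$, $b^*d=-\varepsilon d^*b$, $d^*a+\varepsilon b^*c=1$; equivalently, all $x\in \mathrm{GL}(2m,B)$ with $x^*Jx=J$, where $J=\begin{pmatrix}0&1_m\\ \varepsilon 1_m&0\end{pmatrix}$. The Bruhat elements are $\omega=\begin{pmatrix}0&1\\ \varepsilon&0\end{pmatrix}$, $h_t=\begin{pmatrix}t&0\\ 0&(t^* )^{-1}\end{pmatrix}$ for $t\in A^\times$, and $u_r=\begin{pmatrix}1&r\\ 0&1\end{pmatrix}$ for $r\in A$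 with $r+\varepsilon r^*=0$. $\mathrm{SSL}^{\varepsilon}_*(2,A)$ is the subgroup of $\mathrm{SL}^{\varepsilon}_*(2,A)$ generated by the Bruhat elements. Let $\mathfrak{r}$ be the Jacobson radical of the local ring $B$ and $D=B/\mathfrak{r}$ the corresponding division ring, with the induced involution. $*$ is called ramified if it induces the identity map on $D$, in which case $D=\mathbb{F}$ is a field; otherwise it is unramified. Put $\overline{A}=M(m,D)$ and let $\Omega:\mathrm{SL}^{\varepsilon}_*(2,A)\to\mathrm{SL}^{\varepsilon}_*(2,\overline{A})$ be the homomorphism given by reduction modulo $\mathfrak{r}$. When $\varepsilon=1$ and $*$ is ramified, $\mathrm{SL}^{+}_*(2,\overline{A})$ is the orthogonal group $\mathrm{O}_{2m}(\mathbb{F})$ of the symmetric form with Gram matrix $\begin{pmatrix}0&1_m\\ 1_m&0\end{pmatrix}$, and $\mathrm{SO}_{2m}(\mathbb{F})$ is its subgroup of elements of determinant 1. Finally, $T=\begin{pmatrix}k&e\\ e&k\end{pmatrix}$, where $e\in A$ is the matrix whose only nonzero entry is a $1$ in position $(m,m)$ and $k=1_m-e$; one has $T^2=1_{2m}$ and $T\in\mathrm{SL}^{+}_*(2,A)$. *)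

(* Defs.v *)
From HB Require Import structures.
From mathcomp Require Import all_boot all_order all_algebra.
From mathcomp Require Import boolp classical_sets.

Set Implicit Arguments.
Unset Strict Implicit.
Unset Printing Implicit Defensive.

Import GRing.Theory.
Local Open Scope classical_set_scope.
Local Open Scope ring_scope.

Section Subgroups.
Variable R : pzRingType.
Implicit Types (x y : R) (S G N H : set R).

Definition are_inverse x y := x * y = 1 /\ y * x = 1.

Definition invertible x := exists y, are_inverse x y.

(* Subgroups of the group of units of R, seen as subsets of R. *)
Definition is_subgroup G :=
  [/\ G 1,
      forall x y, G x -> G y -> G (x * y) &
      forall x, G x -> exists2 y, G y & are_inverse x y].

(* Meant for S consisting of invertible elements. *)
Definition generated S : set R := smallest is_subgroup S.

Definition normal_in N G :=
  forall x y n, G x -> are_inverse x y -> N n -> N (x * n * y).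

(* G is the internal semidirect product of N by H, with N normal. *)
Definition internal_sdprod G N H :=
  [/\ [/\ is_subgroup G, is_subgroup N & is_subgroup H],
      N `<=` G /\ H `<=` G,
      normal_in N G,
      G = [set x | exists n h, [/\ N n, H h & x = n * h]] &
      N `&` H = [set 1]].

End Subgroups.

Section LocalRings.
Variable B : nzRingType.

Definition left_ideal (I : set B) :=
  [/\ I 0, forall x y, I x -> I y -> I (x + y) & forall a x, I x -> I (a * x)].

Definition maximal_left_ideal (M : set B) :=
  [/\ left_ideal M, M <> setT &
      forall I, left_ideal I -> M `<=` I -> I = M \/ I = setT].

Definition is_local := exists! M, maximal_left_ideal M.

Definition jacobson : set B := \bigcap_(M in maximal_left_ideal) M.

Lemma left_ideal1 I : left_ideal I -> I 1 -> I = setT.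
Proof.
move=> [_ _ IM] I1; apply/seteqP; split=> // x _.
by rewrite -[x]mulr1; apply: IM.
Qed.

Lemma left_idealN I x : left_ideal I -> I x -> I (- x).
Proof. by move=> [_ _ IM] Ix; rewrite -mulN1r; apply: IM. Qed.

Lemma jacobson_left_ideal : left_ideal jacobson.
Proof.
split=> [M [[]]//|x y Jx Jy M maxM|a x Jx M maxM].
  by have [[_ MD _] _ _] := maxM; apply: MD; [apply: Jx|apply: Jy].
by have [[_ _ MM] _ _] := maxM; apply: MM; apply: Jx.
Qed.

Lemma transporter_maximal M r : maximal_left_ideal M -> ~ M r ->
  maximal_left_ideal [set y | M (y * r)].
Proof.
move=> [[M0 MD MM] MnT Mmax] Mr; split.
- split=> [|x y Mx My|a x Mx] /=.
  + by rewrite mul0r.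
  + by rewrite mulrDl; apply: MD.
  + by rewrite -mulrA; apply: MM.
- by move=> eqT; apply: Mr; have : [set: B] 1 by []; rewrite -eqT /= mul1r.
move=> I idI NI; have [I0 ID IM] := idI.
have [sIN|/existsNP[z /not_implyP[Iz Nz]]] :=
  pselect (I `<=` [set y | M (y * r)]).
  by left; apply/seteqP.
right; apply: left_ideal1 => //.
pose K := [set k | exists m z, [/\ M m, I z & k = m + z * r]].
have idK : left_ideal K.
  split=> [|_ _ [m [y [Mm Iy ->]]] [m' [y' [Mm' Iy' ->]]]|a _ [m [y [Mm Iy ->]]]].
  - by exists 0, 0; split=> //; rewrite mul0r addr0.
  - exists (m + m'), (y + y'); split; [exact: MD|exact: ID|].
    by rewrite mulrDl addrACA.
  - exists (a * m), (a * y); split; [exact: MM|exact: IM|].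
    by rewrite mulrDr mulrA.
have sMK : M `<=` K by move=> m Mm; exists m, 0; split=> //; rewrite mul0r addr0.
case: (Mmax _ idK sMK) => eqK.
  by case: Nz => /=; rewrite -eqK; exists 0, z; split=> //; rewrite add0r.
have [m [y [Mm Iy eqr]]] : K r by rewrite eqK.
have Ny : I (1 - y).
  by apply: NI => /=; rewrite mulrBl mul1r {1}eqr addrK.
by rewrite -(subrK y 1); apply: ID.
Qed.

Lemma jacobson_mulr x r : jacobson x -> jacobson (x * r).
Proof.
move=> Jx M maxM; have [Mr|nMr] := pselect (M r).
  by case: maxM => [[_ _ MM] _ _]; apply: MM.
exact: (Jx _ (transporter_maximal maxM nMr)).
Qed.

Definition jacobson_mem : {pred B} := fun x => `[< jacobson x >].

Lemma jacobsonP x : reflect (jacobson x) (x \in jacobson_mem).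
Proof. exact: asboolP. Qed.

Lemma jacobson_zmod_closed : GRing.zmod_closed jacobson_mem.
Proof.
have idJ := jacobson_left_ideal; have [J0 JD _] := idJ.
split=> [|x y /jacobsonP Jx /jacobsonP Jy]; apply/jacobsonP; first exact: J0.
exact: (JD _ _ Jx (left_idealN idJ Jy)).
Qed.

HB.instance Definition _ :=
  GRing.isZmodClosed.Build B jacobson_mem jacobson_zmod_closed.

(* The ring quotients of the library are restricted to commutative rings, so
   the ring structure on the additive quotient B / jacobson is built here. *)
Definition residue := Quotient.quot jacobson_mem.

HB.instance Definition _ := GRing.Zmodule.on residue.

Definition res (x : B) : residue := \pi_(Quotient.quot jacobson_mem)%qT x.

Lemma res_eq x y : (res x = res y) <-> jacobson (x - y).
Proof.
split=> [/eqP|Jxy]; first by rewrite /res -Quotient.idealrBE => /jacobsonP.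
by apply/eqP; rewrite /res -Quotient.idealrBE; apply/jacobsonP.
Qed.

Lemma res_repr (d : residue) : res (repr d) = d.
Proof. exact: reprK. Qed.

Definition res_one : residue := res 1.
Definition res_mul (c d : residue) : residue := res (repr c * repr d).

Lemma res_mulE x y : res_mul (res x) (res y) = res (x * y).
Proof.
have [_ JD JM] := jacobson_left_ideal.
set x' := repr (res x); set y' := repr (res y).
have Jx : jacobson (x' - x) by apply/res_eq; rewrite res_repr.
have Jy : jacobson (y' - y) by apply/res_eq; rewrite res_repr.
apply/res_eq; rewrite -/x' -/y'.
have -> : x' * y' - x * y = x' * (y' - y) + (x' - x) * y.
  by rewrite mulrBr mulrBl addrA subrK.
by apply: JD; [apply: JM|apply: jacobson_mulr].
Qed.

Lemma res_addE x y : res (x + y) = res x + res y.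
Proof. by rewrite /res !piE. Qed.

Lemma res_mulA : associative res_mul.
Proof.
move=> a b c; rewrite -[a]res_repr -[b]res_repr -[c]res_repr.
by rewrite !res_mulE mulrA.
Qed.

Lemma res_mul1r : left_id res_one res_mul.
Proof. by move=> a; rewrite -[a]res_repr res_mulE mul1r. Qed.

Lemma res_mulr1 : right_id res_one res_mul.
Proof. by move=> a; rewrite -[a]res_repr res_mulE mulr1. Qed.

Lemma res_mulDl : left_distributive res_mul +%R.
Proof.
move=> a b c; rewrite -[a]res_repr -[b]res_repr -[c]res_repr.
by rewrite -res_addE !res_mulE -res_addE mulrDl.
Qed.

Lemma res_mulDr : right_distributive res_mul +%R.
Proof.
move=> a b c; rewrite -[a]res_repr -[b]res_repr -[c]res_repr.
by rewrite -res_addE !res_mulE -res_addE mulrDr.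
Qed.

(* Only a pzRingType: for general B it is neither commutative nor known to be
   nontrivial; it is a division ring when B is local. *)
HB.instance Definition _ := GRing.Zmodule_isPzRing.Build residue
  res_mulA res_mul1r res_mulr1 res_mulDl res_mulDr.

Lemma res_zmod_morphism : zmod_morphism res.
Proof. by move=> x y; rewrite /res !piE. Qed.

HB.instance Definition _ :=
  GRing.isZmodMorphism.Build B residue res res_zmod_morphism.

Lemma res_monoid_morphism : monoid_morphism res.
Proof. by split=> // x y; rewrite -res_mulE. Qed.

HB.instance Definition _ :=
  GRing.isMonoidMorphism.Build B residue res res_monoid_morphism.

Definition is_involution (star : B -> B) :=
  [/\ {morph star : x y / x + y},
      forall x y, star (x * y) = star y * star x &
      involutive star].

(* The map b + r |-> star b + r is the identity of B / r. *)
Definition ramified (star : B -> B) := forall b, res (star b) = res b.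

End LocalRings.

Section Groups.
Variables (B : nzRingType) (star : B -> B) (eps : B) (m : nat).
Implicit Types (a b c d r s t : 'M[B]_m) (x : 'M[B]_(m + m)).

Definition mxstar a : 'M[B]_m := \matrix_(i, j) star (a j i).

Definition SLstar : set 'M[B]_(m + m) := [set x | invertible x /\
  let a := ulsubmx x in let b := ursubmx x in
  let c := dlsubmx x in let d := drsubmx x in
  [/\ mxstar a *m c = - (eps *: (mxstar c *m a)),
      mxstar b *m d = - (eps *: (mxstar d *m b)) &
      mxstar d *m a + eps *: (mxstar b *m c) = 1%:M]].

Definition omega : 'M[B]_(m + m) := block_mx 0 1%:M eps%:M 0.

(* The elements omega, h_t and u_r; in h_t, the matrix s is (t^* )^-1. *)
Definition bruhat : set 'M[B]_(m + m) := [set x |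
  [\/ x = omega,
      exists t s, [/\ invertible t, are_inverse (mxstar t) s &
                      x = block_mx t 0 0 s] |
      exists2 r : 'M[B]_m, r + eps *: mxstar r = 0 & x = block_mx 1%:M r 0 1%:M]].

Definition SSLstar : set 'M[B]_(m + m) := generated bruhat.

Definition e_last : 'M[B]_m := \matrix_(i, j) ((i.+1 == m) && (j.+1 == m))%:R.

Definition Tmx : 'M[B]_(m + m) :=
  block_mx (1%:M - e_last) e_last e_last (1%:M - e_last).

Definition Omega x : 'M[residue B]_(m + m) := map_mx (@res B) x.

End Groups.

Arguments SLstar {B} star eps m.
Arguments omega {B} eps m.
Arguments bruhat {B} star eps m.
Arguments SSLstar {B} star eps m.

Section Orthogonal.
(* Meant for R a field; \det is then the usual determinant. Stated for rings
   because the residue ring is a field only under hypotheses on B. *)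
Variables (R : pzRingType) (m : nat).

Definition gram : 'M[R]_(m + m) := block_mx 0 1%:M 1%:M 0.

Definition Ogrp : set 'M[R]_(m + m) :=
  [set y | invertible y /\ y^T *m gram *m y = gram].

Definition SOgrp : set 'M[R]_(m + m) := [set y | Ogrp y /\ \det y = 1].

End Orthogonal.

Arguments gram R m : clear implicits.
Arguments Ogrp R m : clear implicits.
Arguments SOgrp R m : clear implicits.

(* Main.v *)
Require Import Defs.
From HB Require Import structures.
From mathcomp Require Import all_boot all_order all_algebra perm.
From mathcomp Require Import boolp classical_sets.
From mathcomp Require Import zify.

Set Implicit Arguments.
Unset Strict Implicit.
Unset Printing Implicit Defensive.

Import GRing.Theory.
Local Open Scope classical_set_scope.
Local Open Scope ring_scope.

(** Write x in SL with blocks a, b, c, d and call J the radical of B. If a is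
    invertible, then x has a block LU factorisation, whose factors are Bruhat
    elements up to conjugation by omega. So the task is to make a invertible by
    multiplying x with Bruhat elements, and since B is local a is invertible as
    soon as it has a left inverse modulo J ([left_inverse_mod_invertible]).

    Elements h_t act on c by row and column operations, so Gaussian elimination
    gives c = f modulo J, where f is the projection on the last k coordinates.
    The relation a^* c = - eps c^* a then says that, modulo J, f a = f a f and
    f a f is skew. Multiplying by u_r with r skew replaces f a f by any other
    skew s living in the f corner ([skew_shift]), and invertibility of x makes
    the rest of a harmless: a becomes invertible as soon as s is invertible in
    its corner ([corner_left_inverse]).

    Hence everything depends on the existence of a skew invertible matrix of
    size k. For eps = -1 the identity is one; if * is unramified, so is the
    scalar b - b^* for a suitable b; if eps = 1 and * is ramified, one needs
    an alternating matrix, that is, k even. For k odd an alternating matrix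
    still fills all coordinates but the last, and T, which exchanges the last
    rows of a and c, fills that one. So x is in SSL, or T g x h is for some g
    and h in SSL ([SSL_or_Tmx]).

    It remains to locate T when eps = 1 and * is ramified. For m odd, omega T
    has a lower left block of even rank m - 1, so T is in SSL by the same
    argument. For m even the residue ring is commutative, and the determinant
    modulo J is 1 on the Bruhat elements, omega contributing (-1)^m, but -1 on
    T. So SSL is the kernel of that determinant on SL, and T represents the
    nontrivial coset. *)

(** * Inverses and subgroups *)

Section Inverses.
Variable R : pzRingType.
Implicit Types (x y : R) (S G : set R).

Lemma are_inverseC x y : are_inverse x y -> are_inverse y x.
Proof. by case. Qed.

Lemma are_inverse_uniq x y z : are_inverse x y -> are_inverse x z -> y = z.
Proof. by move=> [_ yx] [xz _]; rewrite -[y]mulr1 -xz mulrA yx mul1r. Qed.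

Lemma are_inverseM x y x' y' :
  are_inverse x y -> are_inverse x' y' -> are_inverse (x * x') (y' * y).
Proof.
move=> [xy yx] [xy' yx']; split.
  by rewrite mulrA -(mulrA x) xy' mulr1.
by rewrite mulrA -(mulrA y') yx mulr1.
Qed.

Lemma are_inverse1 : are_inverse (1 : R) 1.
Proof. by split; rewrite mul1r. Qed.

Lemma invertibleM x y : invertible x -> invertible y -> invertible (x * y).
Proof.
by move=> [x' xx'] [y' yy']; exists (y' * x'); apply: are_inverseM.
Qed.

Lemma invertible_cancel p x q :
  invertible p -> invertible q -> invertible (p * x * q) -> invertible x.
Proof.
move=> [p' [pp' p'p]] [q' [qq' q'q]] inv_pxq.
have -> : x = p' * (p * x * q) * q'.
  by rewrite -!mulrA qq' mulr1 mulrA p'p mul1r.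
apply: invertibleM; last by exists q.
by apply: invertibleM => //; exists p.
Qed.

Lemma subgroupV G x y : is_subgroup G -> G x -> are_inverse x y -> G y.
Proof.
by case=> _ _ GV /GV[z Gz xz] xy; rewrite (are_inverse_uniq xy xz).
Qed.

Lemma subgroup_cancel G g x h : is_subgroup G -> invertible g -> invertible h ->
  G g -> G h -> G (g * x * h) -> G x.
Proof.
move=> sgG [g' gg'] [h' hh'] Gg Gh Ggxh; have [_ GM _] := sgG.
have -> : x = g' * (g * x * h) * h'.
  by case: gg' hh' => [_ g'g] [hh' _]; rewrite -!mulrA hh' mulr1 mulrA g'g mul1r.
by apply: (GM); [apply: GM => //; apply: (subgroupV sgG Gg)|
               apply: (subgroupV sgG Gh)].
Qed.

(** The ambient group G makes inverses exist at all: without it, no subgroup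
    need contain S and the intersection would be the whole ring. *)
Lemma generated_subgroup S G :
  is_subgroup G -> S `<=` G -> is_subgroup (generated S).
Proof.
move=> sgG sSG; split=> [H [[]//]|x y Sx Sy H SH|x Sx].
  by have [[_ HM _] _] := SH; apply: HM; [apply: Sx|apply: Sy].
have [y Gy xy] : exists2 y, G y & are_inverse x y.
  by have [_ _ GV] := sgG; apply/GV/(Sx G).
exists y => // H SH; have [sgH _] := SH.
exact: (subgroupV sgH (Sx H SH) xy).
Qed.

Lemma generated_involution (t : R) :
  t * t = 1 -> generated [set t] = [set 1; t] :> set R.
Proof.
move=> tt; apply/seteqP; split; last first.
  move=> x [->|->] H [[H1 _ _] tH] //; exact: tH.
move=> x; move=> Tx; apply: Tx; split; last by move=> _ ->; right.
split; first by left.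
  by move=> _ _ [->|->] [->|->]; rewrite ?mul1r ?mulr1 ?tt; [left|right|right|left].
move=> _ [->|->]; first by exists 1; [left|split; rewrite mul1r].
by exists t; [right|].
Qed.

End Inverses.

(** * Coordinate projections and a signed antidiagonal *)

Section Coordinates.
Variables (R : pzRingType) (n : nat).

Definition proj l u : 'M[R]_n := diag_mx (\row_i (l <= i < u)%:R).

Definition antidiag l u : 'M[R]_n := \matrix_(i, j)
  if [&& l <= i < u, l <= j < u & (i + j).+1 == l + u]%N
  then (-1) ^+ (j < i)%N else 0.

Lemma projE l u (a : 'M[R]_n) :
  proj l u * a = \matrix_(i, j) if (l <= i < u)%N then a i j else 0.
Proof.
rewrite -mulmxE mul_diag_mx; apply/matrixP => i j; rewrite !mxE.
by case: ifP; rewrite ?mul1r ?mul0r.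
Qed.

Lemma mul_projE l u (a : 'M[R]_n) :
  a * proj l u = \matrix_(i, j) if (l <= j < u)%N then a i j else 0.
Proof.
rewrite -mulmxE mul_mx_diag; apply/matrixP => i j; rewrite !mxE.
by case: ifP; rewrite ?mulr1 ?mulr0.
Qed.

Lemma proj_entry l u i j :
  proj l u i j = if (l <= i < u)%N && (i == j) then 1 else 0.
Proof. rewrite !mxE; have [->|_] := eqVneq i j; last by rewrite andbF.
by case: (l <= j < u)%N. Qed.

Lemma proj_idem l u : proj l u * proj l u = proj l u.
Proof.
by rewrite projE; apply/matrixP => i j; rewrite mxE proj_entry; case: (l <= i < u)%N.
Qed.

Lemma proj_full : proj 0 n = 1.
Proof.
apply/matrixP => i j; rewrite proj_entry mxE ltn_ord /=.
by case: eqP.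
Qed.

Lemma proj_disjoint l u v : proj l u * proj u v = 0.
Proof.
rewrite projE; apply/matrixP => i j; rewrite mxE proj_entry mxE.
by case: ifP => // h; case: ifP => // h'; exfalso; lia.
Qed.

Lemma proj_disjointC l u v : proj u v * proj l u = 0.
Proof.
rewrite projE; apply/matrixP => i j; rewrite mxE proj_entry mxE.
by case: ifP => // h; case: ifP => // h'; exfalso; lia.
Qed.

Lemma proj_cat l u v : (l <= u <= v)%N -> proj l u + proj u v = proj l v.
Proof.
move=> luv; apply/matrixP => i j; rewrite mxE !proj_entry.
case: (i == j); rewrite ?andbF ?andbT ?addr0 //.
have [li|li] := leqP l i; have [iu|iu] := ltnP i u; have [iv|iv] := ltnP i v;
  rewrite /= ?addr0 ?add0r //; lia.
Qed.

Lemma proj_antidiag l u : proj l u * antidiag l u = antidiag l u.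
Proof.
by rewrite projE; apply/matrixP => i j; rewrite !mxE; case: (l <= i < u)%N.
Qed.

Lemma antidiag_proj l u : antidiag l u * proj l u = antidiag l u.
Proof.
rewrite mul_projE; apply/matrixP => i j; rewrite !mxE.
by case: (l <= j < u)%N; rewrite ?andbF.
Qed.

Lemma antidiag_tr l u : ~~ odd (l + u) -> (antidiag l u)^T = - antidiag l u.
Proof.
move=> even_lu; apply/matrixP => i j; rewrite !mxE addnC.
rewrite [in LHS]andbCA; case: ifP => [/and3P[_ _ /eqP ij]|_]; last by rewrite oppr0.
have [ltij|ltji|eqij] := ltngtP i j; rewrite ?expr0 ?expr1 ?opprK //.
by move: even_lu; rewrite -ij eqij /= addnn odd_double.
Qed.

(** The antidiagonal pairs i with l + u - 1 - i, with opposite signs on the two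
    sides of the middle; an interval of even length has no middle point. *)
Lemma antidiag_sqr l u : (u <= n)%N -> ~~ odd (l + u) ->
  antidiag l u * antidiag l u = - proj l u.
Proof.
move=> le_un even_lu; apply/matrixP => i j; rewrite -mulmxE mxE [RHS]mxE proj_entry.
have [lu|Nlu] := boolP (l <= i < u)%N; last first.
  by rewrite big1 ?oppr0 // => k _; rewrite mxE (negPf Nlu) mul0r.
have ltk : (l + u - i.+1 < n)%N by lia.
rewrite (bigD1 (Ordinal ltk)) //= big1 ?addr0 => [|k]; last first.
  rewrite -val_eqE /= => ki; rewrite mxE; case: ifP; rewrite ?mul0r //; lia.
rewrite !mxE /= lu /=; have -> : (l <= l + u - i.+1 < u)%N by lia.
have -> : (i + (l + u - i.+1)).+1 == (l + u)%N by lia.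
have [<-|ij] := eqVneq i j; last first.
  case: ifP => [/and3P[_ _ ]|_]; last by rewrite mulr0 oppr0.
  by move: ij; rewrite -val_eqE /=; lia.
rewrite lu /=; have -> : (l + u - i.+1 + i).+1 == (l + u)%N by lia.
have [h|h|h] := ltngtP (l + u - i.+1)%N i; rewrite ?mulr1 ?mul1r ?expr1 ?expr0 //.
  by move: even_lu; rewrite (_ : (l + u = i.*2.+1)%N) ?odd_double ?oddS //=; lia.
Qed.

End Coordinates.

Arguments proj {R n} l u.
Arguments antidiag {R n} l u.

Lemma map_proj (R S : pzRingType) (f : {rmorphism R -> S}) n l u :
  map_mx f (proj l u : 'M[R]_n) = proj l u.
Proof.
apply/matrixP => i j; rewrite mxE !proj_entry.
by case: ifP; rewrite ?rmorph1 ?rmorph0.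
Qed.

Lemma e_last_proj (B : nzRingType) m : (1 <= m)%N -> e_last B m = proj m.-1 m.
Proof.
move=> m_gt0; apply/matrixP => i j; rewrite proj_entry mxE.
have [<-|ij] := eqVneq i j.
  by rewrite andbb andbT; case: eqP => [|] h; case: ifP => //; have := ltn_ord i; lia.
case: andP => [[/eqP h1 /eqP h2]|]; last by rewrite andbF.
by case/eqP: ij; apply/val_inj/eqP; rewrite -eqSS h1 h2.
Qed.

(** * Local rings *)

Section LocalRing.
Variable B : nzRingType.
Hypothesis B_local : is_local B.

Lemma proper_left_ideal_sub_maximal (K : set B) : left_ideal K -> ~ K 1 ->
  exists2 M, maximal_left_ideal M & K `<=` M.
Proof.
move=> idK NK1; have [K0 KD KM] := idK.
(* The union with K keeps the empty chain harmless. *)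
pose P I := left_ideal (I `|` K) /\ ~ (I `|` K) 1.
have [F FP tF|A [[idA NA1] maxA]] := @Zorn_bigcup B P.
  have chain x y : (\bigcup_(X in F) X `|` K) x ->
      (\bigcup_(X in F) X `|` K) y ->
      (K x /\ K y) \/ exists X, [/\ F X, (X `|` K) x & (X `|` K) y].
    move=> [[X FX Xx]|Kx] [[Y FY Yy]|Ky]; last by left.
    - by right; have [sXY|sYX] := tF _ _ FX FY; [exists Y|exists X];
        split=> //; left=> //; [apply: sXY|apply: sYX].
    - by right; exists X; split=> //; [left|right].
    - by right; exists Y; split=> //; [right|left].
  have sub X : F X -> X `|` K `<=` \bigcup_(X in F) X `|` K.
    by move=> FX x [Xx|]; [left; exists X|right].
  split; last by case=> // -[X FX X1]; have [_ []] := FP _ FX; left.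
  split=> [|x y Ux Uy|a x Ux]; first by right.
    have [[Kx Ky]|[X [FX Xx Xy]]] := chain _ _ Ux Uy; first by right; apply: KD.
    by apply: (sub X FX); have [[_ XD _] _] := FP _ FX; apply: XD.
  have [[Kx _]|[X [FX Xx _]]] := chain _ _ Ux Ux; first by right; apply: KM.
  by apply: (sub X FX); have [[_ _ XM] _] := FP _ FX; apply: XM.
exists (A `|` K); last by move=> x; right.
split=> [//|eqT|I idI sAI]; first by apply: NA1; rewrite eqT.
have [I1|NI1] := pselect (I 1); first by right; apply: left_ideal1.
left; apply/seteqP; split=> // x Ix; left; apply: contrapT => NAx.
have IUK : I `|` K = I.
  by apply/seteqP; split=> y; [case=> // Ky; apply: sAI; right|left].
apply: (maxA I); last by split; rewrite IUK.
split; first by move=> y Ay; apply: sAI; left.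
by move=> /(_ x Ix).
Qed.

Lemma jacobson_maximal : maximal_left_ideal (jacobson (B := B)).
Proof.
have [M [maxM uniqM]] := B_local.
suff -> : jacobson (B := B) = M by [].
by apply/seteqP; split=> [x|x Mx N /uniqM <-//]; apply.
Qed.

Lemma jacobson_one : ~ jacobson (1 : B).
Proof.
by move=> J1; have [idJ JnT _] := jacobson_maximal; apply/JnT/left_ideal1.
Qed.

Lemma nonjacobson_left_inverse (x : B) : ~ jacobson x -> exists y, y * x = 1.
Proof.
move=> Nx; pose K := [set z | exists y, z = y * x].
have idK : left_ideal K.
  split=> [|_ _ [a ->] [b ->]|a _ [b ->]]; first by exists 0; rewrite mul0r.
    by exists (a + b); rewrite mulrDl.
  by exists (a * b); rewrite mulrA.
have [[y]|NK1] := pselect (K 1); first by exists y.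
have [M maxM sKM] := proper_left_ideal_sub_maximal idK NK1.
case: Nx => N maxN; have [L [_ uniqL]] := B_local.
by rewrite -(uniqL _ maxN) (uniqL _ maxM); apply: sKM; exists 1; rewrite mul1r.
Qed.

(** The radical is a two-sided ideal, so a left inverse of x lies outside it too
    and has a left inverse of its own. *)
Lemma nonjacobson_invertible (x : B) : ~ jacobson x -> invertible x.
Proof.
move=> Nx; have [y yx] := nonjacobson_left_inverse Nx.
have Ny : ~ jacobson y.
  by move=> Jy; apply: jacobson_one; rewrite -yx; apply: jacobson_mulr.
have [z zy] := nonjacobson_left_inverse Ny.
have xz : x = z by rewrite -[x]mul1r -zy -mulrA yx mulr1.
by exists y; split=> //; rewrite xz.
Qed.

Lemma res_eq0 (x : B) : res x = 0 <-> jacobson x.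
Proof. by rewrite -(rmorph0 (@res B)) res_eq subr0. Qed.

Lemma invertible_resP (x : B) : invertible x <-> res x <> 0.
Proof.
split=> [[y [xy _]] /res_eq0 Jx|Nx]; last first.
  by apply: nonjacobson_invertible => /res_eq0.
by apply: jacobson_one; rewrite -xy; apply: jacobson_mulr.
Qed.

Lemma residue_oner_neq0 : 1 != 0 :> residue B.
Proof.
by apply/eqP => /eqP; rewrite -(rmorph1 (@res B)) => /eqP/res_eq0/jacobson_one.
Qed.

(** * Matrices over a local ring *)

Local Notation "a ^r" := (map_mx (@res B) a) (at level 2, format "a ^r").

Lemma invertible_map n (a : 'M[B]_n) : invertible a -> invertible a^r.
Proof.
move=> [b [ab ba]]; exists b^r.
split; rewrite -[LHS](map_mxM (@res B)); first by rewrite [_ *m _]ab map_mx1.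
by rewrite [_ *m _]ba map_mx1.
Qed.

Lemma block_diag_inverse (R : pzRingType) n1 n2
    (a a' : 'M[R]_n1) (d d' : 'M[R]_n2) :
  are_inverse a a' -> are_inverse d d' ->
  are_inverse (block_mx a 0 0 d) (block_mx a' 0 0 d').
Proof.
move=> [aa' a'a] [dd' d'd].
split; rewrite -[LHS]/(_ *m _) mulmx_block !mul0mx !mulmx0 !addr0 !add0r.
  by rewrite [a *m a']aa' [d *m d']dd' -scalar_mx_block.
by rewrite [a' *m a]a'a [d' *m d]d'd -scalar_mx_block.
Qed.

Lemma block_diag_invertible (R : pzRingType) n1 n2 (d : 'M[R]_n2) :
  invertible d -> invertible (block_mx 1%:M 0 0 d : 'M[R]_(n1 + n2)).
Proof.
move=> [d' dd']; exists (block_mx 1%:M 0 0 d').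
by apply: block_diag_inverse => //; apply: are_inverse1.
Qed.

Lemma perm_mx_invertible (R : pzRingType) n (s : 'S_n) :
  invertible (perm_mx s : 'M[R]_n).
Proof.
exists (perm_mx s^-1)%g.
by split; rewrite -[_ * _]/(_ *m _) -perm_mxM ?(mulgV, mulVg) perm_mx1.
Qed.

(** The pivot is an entry outside the radical, hence a unit since B is local. *)
Lemma pivot_step n (a : 'M[B]_(1 + n)) : a^r <> 0 ->
  exists p q, exists z : 'M[B]_n,
    [/\ invertible p, invertible q & p * a * q = block_mx 1%:M 0 0 z].
Proof.
move=> a_neq0.
have [i [j aij]] : exists i j, res (a i j) <> 0.
  apply: contrapT => H; apply: a_neq0; apply/matrixP => i j; rewrite !mxE.
  by apply: contrapT => H'; apply: H; exists i, j.
have {aij} [b [ab ba]] : invertible (a i j) by apply/invertible_resP.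
pose c := tperm_mx 0 i * a * tperm_mx 0 j : 'M_(1 + n).
have c00 : c 0 0 = a i j.
  by rewrite /c -!mulmxE -xrowE -xcolE !mxE !perm.tpermL.
have ul : ulsubmx c = (a i j)%:M.
  rewrite [ulsubmx c]mx11_scalar; congr (_%:M); rewrite 2!mxE -c00.
  by congr (c _ _); apply/val_inj.
pose l := block_mx 1%:M 0 (- (dlsubmx c *m b%:M)) 1%:M : 'M[B]_(1 + n).
pose r := block_mx b%:M (- (b%:M *m ursubmx c)) 0 1%:M : 'M[B]_(1 + n).
have inv_l : invertible l.
  exists (block_mx 1%:M 0 (dlsubmx c *m b%:M) 1%:M).
  split; rewrite -[_ * _]/(_ *m _) mulmx_block !mul0mx !mulmx0 !mulmx1 !mul1mx.
    by rewrite !addr0 add0r addNr -scalar_mx_block.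
  by rewrite !addr0 add0r subrr -scalar_mx_block.
have inv_r : invertible r.
  exists (block_mx (a i j)%:M (ursubmx c) 0 1%:M).
  split; rewrite -[_ * _]/(_ *m _) mulmx_block !mul0mx !mulmx0 !mulmx1 ?mul1mx.
    by rewrite -scalar_mxM ba subrr !addr0 add0r -scalar_mx_block.
  rewrite mulmxN mulmxA -scalar_mxM ab mul1mx addNr !addr0 add0r.
  by rewrite -scalar_mx_block.
exists (l * tperm_mx 0 i), (tperm_mx 0 j * r).
exists (drsubmx c - dlsubmx c *m b%:M *m ursubmx c); split.
- by apply: invertibleM => //; apply: perm_mx_invertible.
- by apply: invertibleM => //; apply: perm_mx_invertible.
have -> : l * tperm_mx 0 i * a * (tperm_mx 0 j * r) = l * c * r.
  by rewrite /c !mulrA.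
rewrite -!mulmxE -[c]submxK ul /l /r !mulmx_block.
rewrite !mul0mx !mulmx0 !mulmx1 !mul1mx !addr0 !mulNmx.
rewrite block_mxKdr block_mxKdl block_mxKur.
rewrite -[dlsubmx c *m _ *m (a i j)%:M]mulmxA -!scalar_mxM ab ba mulmx1 addNr.
rewrite !mul0mx add0r mulmxN mulmxA -scalar_mxM ab mul1mx addNr.
by congr block_mx; rewrite addrC.
Qed.

(** Without a determinant, units of the matrix ring are recognised by
    elimination: each pivot step carries the left inverse modulo the radical to
    the remaining block, which therefore never reduces to zero. *)
Lemma left_inverse_mod_invertible n (a : 'M[B]_n) (y : 'M[residue B]_n) :
  y * a^r = 1 -> invertible a.
Proof.
elim: n a y => [|n IHn] a y ya.
  by exists 0; split; apply/matrixP => -[].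
have [a0|/(@pivot_step n)[p [q [z [inv_p inv_q paq]]]]] := pselect (a^r = 0).
  have := residue_oner_neq0; case/eqP.
  have /matrixP/(_ 0 0) := ya; rewrite a0 -mulmxE mulmx0 !mxE eqxx => /esym.
  exact.
apply: (invertible_cancel inv_p inv_q); rewrite paq.
have [p' [pp' p'p]] := inv_p; have [q' [qq' q'q]] := inv_q.
pose w : 'M[residue B]_(1 + n) := q'^r * y * p'^r.
have wz : w * (block_mx 1%:M 0 0 z)^r = 1.
  rewrite -paq -!mulmxE !map_mxM /= !mulmxA !mulmxE -!mulrA.
  rewrite [p'^r * _]mulrA -[p'^r * p^r](map_mxM (@res B)).
  rewrite [p' *m p]p'p (map_mx1 (@res B)) mul1r.
  rewrite [y * _]mulrA ya mul1r -[q'^r * _](map_mxM (@res B)).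
  by rewrite [q' *m q]q'q (map_mx1 (@res B)).
apply: block_diag_invertible; apply: (IHn z (drsubmx w)).
  have := congr1 drsubmx wz; rewrite -{1}[w]submxK map_block_mx.
  rewrite -mulmxE mulmx_block block_mxKdr (map_mx0 (@res B)) mulmx0 add0r => drE.
  rewrite -[LHS]/(drsubmx w *m z^r) drE.
  by rewrite -[1]/(1%:M) scalar_mx_block block_mxKdr.
Qed.

(** Only the rank of the reduction matters, so it is enough to reach the normal
    form modulo the radical. *)
Lemma rank_normal_form n (a : 'M[B]_n) : exists p q k,
  [/\ invertible p, invertible q, (k <= n)%N & (p * a * q)^r = pid_mx k].
Proof.
elim: n a => [|n IHn] a.
  exists 0, 0, 0%N; split=> //; last by apply/matrixP => -[].
    by exists 0; split; apply/matrixP => -[].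
  by exists 0; split; apply/matrixP => -[].
have [a0|/(@pivot_step n)[p [q [z [inv_p inv_q paq]]]]] := pselect (a^r = 0).
  exists 1, 1, 0%N; rewrite mul1r mulr1 a0 pid_mx_0.
  by split=> //; exists 1; apply: are_inverse1.
have [p' [q' [k [inv_p' inv_q' le_kn pzq]]]] := IHn z.
pose p1 : 'M[B]_(1 + n) := block_mx 1%:M 0 0 p'.
pose q1 : 'M[B]_(1 + n) := block_mx 1%:M 0 0 q'.
exists (p1 * p), (q * q1), k.+1; split=> //.
- by apply: invertibleM; [exact: (block_diag_invertible 1 inv_p')|done].
- by apply: invertibleM; [done|exact: (block_diag_invertible 1 inv_q')].
have -> : p1 * p * a * (q * q1) = block_mx 1%:M 0 0 (p' * z * q').
  rewrite -!mulrA [p * _]mulrA [p * a * _]mulrA paq -!mulmxE /p1 /q1 !mulmx_block.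
  by rewrite !mul0mx !mulmx0 !mul1mx !addr0 !add0r mulmx0 mulmxA.
rewrite (map_block_mx (@res B) (1%:M : 'M_1) 0 0 (p' * z * q')) pzq.
rewrite (map_mx1 (@res B)) !(map_mx0 (@res B)).
apply/matrixP => i j; rewrite mxE.
case: splitP => i' ii'; rewrite mxE; case: splitP => j' jj'; rewrite !mxE ii' jj'.
- by rewrite !ord1.
- by rewrite (ord1 i').
- by rewrite (ord1 j').
- by rewrite !add1n eqSS ltnS.
Qed.

(** Conjugating by the reversal of coordinates puts the pivots last, where the
    element T acts. *)
Lemma rank_normal_form_last n (a : 'M[B]_n) : exists p q l,
  [/\ invertible p, invertible q, (l <= n)%N & (p * a * q)^r = proj l n].
Proof.
have [p [q [k [inv_p inv_q le_kn paq]]]] := rank_normal_form a.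
pose s : 'S_n := perm.perm (@rev_ord_inj n).
exists (perm_mx s * p), (q * perm_mx s^-1%g), (n - k)%N.
split; [| |exact: leq_subr|].
- by apply: invertibleM => //; apply: perm_mx_invertible.
- by apply: invertibleM => //; apply: perm_mx_invertible.
have -> : perm_mx s * p * a * (q * perm_mx s^-1%g) =
    row_perm s (col_perm s (p * a * q)).
  by rewrite row_permE col_permE !mulmxE !mulrA.
rewrite map_row_perm map_col_perm paq; apply/matrixP => i j.
rewrite proj_entry !mxE !perm.permE /=; have lti := ltn_ord i; have ltj := ltn_ord j.
have -> : (n - i.+1 == n - j.+1)%N = (i == j) by rewrite -val_eqE /=; lia.
have -> : (n - i.+1 < k)%N = (n - k <= i)%N by lia.
by rewrite lti; case: (i == j); case: (n - k <= i)%N.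
Qed.

End LocalRing.
(** * Invertibility in a corner *)

(** Since a is block triangular for f and 1 - f, a left inverse of the column
    (a, f) yields one for the 1 - f corner of a, whatever the f corner is; so
    the latter can be replaced by any s with a left inverse s' there. *)
Lemma corner_left_inverse (A : pzRingType) (a f s s' y1 y2 : A) :
    y1 * a + y2 * f = 1 -> f * f = f -> f * a = f * a * f ->
    f * s = s -> s' * f = s' -> s' * s = f ->
  (y1 * (1 - f) + (y1 * f * a + y2) * s') * ((1 - f) * a + s) = 1.
Proof.
move=> y12 ff fa fs s'f s's.
have t1 : (1 - f) * ((1 - f) * a + s) = (1 - f) * a.
  rewrite mulrDr mulrA.
  have -> : (1 - f) * (1 - f) = 1 - f.
    by rewrite mulrBr mulr1 mulrBl mul1r ff subrr subr0.
  by rewrite [(1 - f) * s]mulrBl mul1r fs subrr addr0.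
have t2 : s' * ((1 - f) * a + s) = f.
  by rewrite mulrDr mulrA mulrBr mulr1 s'f subrr mul0r add0r.
rewrite mulrDl -!mulrA t1 t2 -[RHS]y12 mulrBl mul1r mulrBr mulrDl -!mulrA.
by rewrite [f * (a * f)]mulrA -fa addrA subrK.
Qed.

(** * The involution on matrices *)

Section Involution.
Variables (B : nzRingType) (star : B -> B).
Hypothesis star_inv : is_involution star.

Local Notation "a ^*" := (mxstar star a) : ring_scope.

Lemma starD : {morph star : x y / x + y}. Proof. by case: star_inv. Qed.
Lemma starM x y : star (x * y) = star y * star x. Proof. by case: star_inv. Qed.
Lemma starK : involutive star. Proof. by case: star_inv. Qed.
Lemma star0 : star 0 = 0.
Proof. by apply: (addrI (star 0)); rewrite -starD !addr0. Qed.
Lemma starN x : star (- x) = - star x.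
Proof. by apply: (addrI (star x)); rewrite -starD !subrr star0. Qed.
Lemma star1 : star 1 = 1.
Proof. by rewrite -[LHS]mul1r -{1}[1]starK -starM mul1r starK. Qed.

Lemma star_sum I (r : seq I) (P : pred I) F :
  star (\sum_(i <- r | P i) F i) = \sum_(i <- r | P i) star (F i).
Proof. exact: (big_morph _ starD star0). Qed.

Section Size.
Variable n : nat.
Implicit Types a b : 'M[B]_n.

Lemma mxstarD a b : (a + b)^* = a^* + b^*.
Proof. by apply/matrixP => i j; rewrite !mxE starD. Qed.
Lemma mxstarN a : (- a)^* = - a^*.
Proof. by apply/matrixP => i j; rewrite !mxE starN. Qed.
Lemma mxstarB a b : (a - b)^* = a^* - b^*.
Proof. by rewrite mxstarD mxstarN. Qed.
Lemma mxstarM a b : (a * b)^* = b^* * a^*.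
Proof.
apply/matrixP => i j; rewrite !mxE star_sum; apply: eq_bigr => k _.
by rewrite starM !mxE.
Qed.
Lemma mxstarK a : a^*^* = a.
Proof. by apply/matrixP => i j; rewrite !mxE starK. Qed.
Lemma mxstar0 : (0 : 'M[B]_n)^* = 0.
Proof. by apply/matrixP => i j; rewrite !mxE star0. Qed.
Lemma mxstar_scalar x : (x%:M : 'M[B]_n)^* = (star x)%:M.
Proof.
by apply/matrixP => i j; rewrite !mxE eq_sym; case: eqP; rewrite ?mulr1n ?mulr0n ?star0.
Qed.
Lemma mxstar1 : (1 : 'M[B]_n)^* = 1.
Proof. by rewrite mxstar_scalar star1. Qed.
Lemma mxstar_proj l u : (proj l u : 'M[B]_n)^* = proj l u.
Proof.
apply/matrixP => i j; rewrite mxE !proj_entry [j == i]eq_sym.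
by have [->|_] := eqVneq i j; rewrite ?andbF ?star0 //; case: ifP;
  rewrite ?star1 ?star0.
Qed.
Lemma mxstar_antidiag l u : ~~ odd (l + u) ->
  (antidiag l u : 'M[B]_n)^* = - antidiag l u.
Proof.
move=> /(antidiag_tr B n) <-; apply/matrixP => i j; rewrite !mxE.
by case: ifP; rewrite ?star0 // => _; case: (i < j)%N; rewrite ?expr1 ?expr0 ?starN star1.
Qed.

Lemma are_inverse_star a b : are_inverse a b -> are_inverse b^* a^*.
Proof. by move=> [ab ba]; split; rewrite -mxstarM ?ab ?ba mxstar1. Qed.

End Size.

Lemma mxstar_block m (a b c d : 'M[B]_m) :
  (block_mx a b c d)^* = block_mx a^* c^* b^* d^*.
Proof.
apply/matrixP => i j; rewrite mxE.
by case: (split_ordP i) => i' ->; case: (split_ordP j) => j' ->;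
  rewrite ?(block_mxEul, block_mxEur, block_mxEdl, block_mxEdr) !mxE.
Qed.

Hypothesis B_local : is_local B.

(** An involution preserves the units, hence also the set of nonunits, which is
    the radical. *)
Lemma res_star x y : res x = res y -> res (star x) = res (star y).
Proof.
move=> xy; apply/eqP; rewrite -subr_eq0 -rmorphB -starN -starD; apply/eqP.
apply: contrapT => /(invertible_resP B_local)[w [w1 w2]].
have : invertible (x - y).
  by exists (star w); split; rewrite -[x - y]starK -starM ?w1 ?w2 star1.
by move/(invertible_resP B_local); rewrite rmorphB /= xy subrr.
Qed.

End Involution.
(** * The unitary group and its Bruhat elements *)

Local Notation mul01E := (mulr0, mul0r, mulr1, mul1r, addr0, add0r).

Section Unitary.
Variables (B : nzRingType) (star : B -> B) (eps : B) (m : nat).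
Hypotheses (star_inv : is_involution star) (eps_pm1 : eps = 1 \/ eps = -1).

Local Notation "a ^*" := (mxstar star a) : ring_scope.
Local Notation A := 'M[B]_m.
Local Notation SL := (SLstar star eps m).
Local Notation SSL := (SSLstar star eps m).
Local Notation w := (omega eps m).
Implicit Types a b c d r s t : A.

(** The sign as an element of A, so that every computation is one in A. *)
Let e : A := eps%:M.

Lemma scale_sign a : eps *: a = e * a.
Proof. by rewrite -mulmxE mul_scalar_mx. Qed.

Lemma sign_pm1 : e = 1 \/ e = -1.
Proof.
by case: eps_pm1 => h; [left|right]; rewrite /e h // (rmorphN (@scalar_mx B m)).
Qed.

Lemma signC a : e * a = a * e.
Proof. by case: sign_pm1 => ->; rewrite ?mul1r ?mulr1 // mulN1r mulrN1. Qed.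

Lemma sign_sqr : e * e = 1.
Proof. by case: sign_pm1 => ->; rewrite ?mulrNN mul1r. Qed.

Lemma signK a : e * (e * a) = a.
Proof. by rewrite mulrA sign_sqr mul1r. Qed.

Lemma star_sign : e^* = e.
Proof. by case: sign_pm1 => ->; rewrite ?mxstarN // mxstar1. Qed.

Lemma skew_star r : r + eps *: r^* = 0 <-> r^* = - (e * r).
Proof.
rewrite scale_sign; split=> [/(canRL (addrK _))|->].
  by rewrite add0r => {2}->; rewrite mulrN signK opprK.
by rewrite mulrN signK subrr.
Qed.

Lemma SLstar_block a b c d : SL (block_mx a b c d) <->
  invertible (block_mx a b c d) /\
  [/\ a^* * c = - (e * (c^* * a)), b^* * d = - (e * (d^* * b)) &
      d^* * a + e * (b^* * c) = 1].
Proof.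
by rewrite /SLstar /= block_mxKul block_mxKur block_mxKdl block_mxKdr
  !scale_sign.
Qed.

Lemma block_mulE a b c d a' b' c' d' :
  block_mx a b c d * block_mx a' b' c' d' =
  block_mx (a * a' + b * c') (a * b' + b * d') (c * a' + d * c') (c * b' + d * d')
  :> 'M[B]_(m + m).
Proof. exact: mulmx_block. Qed.

Lemma block_oneE : 1 = block_mx 1 0 0 1 :> 'M[B]_(m + m).
Proof. exact: scalar_mx_block. Qed.

Lemma omegaE : w = block_mx 0 1 e 0.
Proof. by []. Qed.

(** In this form, closure under products and inverses is immediate. *)
Lemma SLstarP x : SL x <-> invertible x /\ x^* * w * x = w.
Proof.
rewrite -[x]submxK; move: (ulsubmx x) (ursubmx x) (dlsubmx x) (drsubmx x).
move=> a b c d; rewrite SLstar_block mxstar_block omegaE !block_mulE.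
rewrite !mulr0 !mulr1 !add0r !addr0 -/e -!signC -!mulrA.
split=> [[inv [h1 h2 h3]]|[inv /eq_block_mx[h1 _ h3 h2]]]; split=> //.
  congr block_mx.
  - by rewrite h1 subrr.
  - have := congr1 (fun x : A => x^*) h3.
    rewrite mxstarD // !mxstarM // !mxstarK // star_sign mxstar1 // addrC -signC; exact.

  - by rewrite -[b^* * c]signK -mulrDr h3 mulr1.
  - by rewrite h2 subrr.
split.
- by apply/eqP; rewrite -addr_eq0 addrC h1.
- by apply/eqP; rewrite -addr_eq0 addrC h2.
- by rewrite -[d^* * a]signK -mulrDr h3 sign_sqr.
Qed.

Lemma SL_subgroup : is_subgroup SL.
Proof.
split=> [|x y /SLstarP[inv_x xx] /SLstarP[inv_y yy]|x /SLstarP[[y xy] xx]].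
- apply/SLstarP; split; first by exists 1; apply: are_inverse1.
  by rewrite mxstar1 // mul1r mulr1.
- apply/SLstarP; split; first exact: invertibleM.
  by rewrite mxstarM // -!mulrA [w * _]mulrA [x^* * _]mulrA [x^* * _]mulrA xx mulrA.
exists y => //; apply/SLstarP; split; first by exists x; apply: are_inverseC.
have [xy1 yx1] := xy.
by rewrite -{1}xx -!mulrA xy1 mulr1 mulrA -mxstarM // xy1 mxstar1 // mul1r.
Qed.

Lemma SL_omega : SL w.
Proof.
apply/SLstarP; split.
  exists (block_mx 0 e 1 0).
  by split; rewrite omegaE !block_mulE !mul01E
    sign_sqr block_oneE.
rewrite omegaE mxstar_block !mxstar0 // mxstar1 // star_sign !block_mulE.
by rewrite !mul01E sign_sqr.
Qed.

Lemma bruhat_sub_SL : bruhat star eps m `<=` SL.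
Proof.
move=> x [->|[t [s [[t' tt'] ts ->]]]|[r /skew_star rr ->]].
- exact: SL_omega.
- apply/SLstar_block; rewrite !mxstar0 // !mulr0 !mul0r !mulr0 oppr0 addr0.
  split.
    exists (block_mx t' 0 0 t^*).
    by apply: block_diag_inverse => //; apply: are_inverseC.
  split=> //; have [t_s _] := ts.
  by rewrite -[t](mxstarK star_inv) -mxstarM // t_s mxstar1.
apply/SLstar_block; rewrite mxstar0 // mxstar1 // !mulr0 !mul1r !mulr1 mulr0 oppr0.
rewrite addr0 rr; split=> //; exists (block_mx 1 (- r) 0 1).
by split; rewrite !block_mulE !mul01E
  ?(subrr, addNr) block_oneE.
Qed.

Lemma SSL_subgroup : is_subgroup SSL.
Proof. exact: generated_subgroup SL_subgroup bruhat_sub_SL. Qed.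

Lemma SSL_sub_SL : SSL `<=` SL.
Proof. exact: smallest_sub SL_subgroup bruhat_sub_SL. Qed.

Lemma SSL_omega : SSL w.
Proof. by apply: sub_gen_smallest; constructor 1. Qed.

Lemma SSL_diag t s : invertible t -> are_inverse t^* s ->
  SSL (block_mx t 0 0 s).
Proof. by move=> inv_t ts; apply: sub_gen_smallest; constructor 2; exists t, s. Qed.

Lemma SSL_upper r : r^* = - (e * r) -> SSL (block_mx 1 r 0 1).
Proof.
by move=> /skew_star rr; apply: sub_gen_smallest; constructor 3; exists r.
Qed.

(** Conjugating u_r by omega makes it lower triangular. *)
Lemma SSL_lower r : r^* = - (e * r) -> SSL (block_mx 1 0 r 1).
Proof.
move=> rr; have [_ SSLM _] := SSL_subgroup.
have inv_w : are_inverse w (block_mx 0 e 1 0).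
  by split; rewrite omegaE !block_mulE !mul01E
    sign_sqr block_oneE.
have SSLw' := subgroupV SSL_subgroup SSL_omega inv_w.
have SSLu : SSL (block_mx 1 (e * r) 0 1).
  by apply: SSL_upper; rewrite mxstarM // star_sign rr mulNr -signC.
have -> : block_mx 1 0 r 1 = w * block_mx 1 (e * r) 0 1 * block_mx 0 e 1 0
    :> 'M[B]_(m + m).
  rewrite omegaE !block_mulE !mul01E.
  by rewrite -/e signK sign_sqr.
by apply: (SSLM) SSLw'; apply: SSLM SSLu; exact: SSL_omega.
Qed.

(** In the block LU factorisation of x the outer factors involve c a^-1 and
    a^-1 b, which unitarity makes skew. *)
Lemma SSL_of_invertible_corner a b c d :
  SL (block_mx a b c d) -> invertible a -> SSL (block_mx a b c d).
Proof.
move=> SLx [a' [aa' a'a]]; have [_ SSLM _] := SSL_subgroup.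
have [_ [h1 _ _]] := (SLstar_block a b c d).1 SLx.
have aa's : a'^* * a^* = 1 by rewrite -mxstarM // aa' mxstar1.
have rE : c * a' = - (e * (c * a')^*).
  rewrite -[LHS]mul1r -aa's -!mulrA [a^* * _]mulrA h1 mulNr mulrN mxstarM //.
  by rewrite -!mulrA aa' mulr1 mulrA -signC -mulrA.
have skew_l : (c * a')^* = - (e * (c * a')).
  by rewrite {2}rE mulrN opprK signK.
have l_inv : are_inverse (block_mx 1 0 (- (c * a')) 1) (block_mx 1 0 (c * a') 1).
  by split; rewrite !block_mulE !mul01E
    ?(subrr, addNr) block_oneE.
have SSLl := SSL_lower skew_l.
have SSLl' := subgroupV SSL_subgroup SSLl (are_inverseC l_inv).
have SLy : SL (block_mx a b 0 (d - c * a' * b)).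
  have [_ SLM _] := SL_subgroup.
  have := SLM _ _ (SSL_sub_SL SSLl') SLx.
  rewrite block_mulE !mul1r !mul0r !addr0 !mulNr -[c * a' * a]mulrA a'a mulr1 addNr.
  by rewrite [- _ + d]addrC.
move: SLy; set d' := d - _ => /SLstar_block[_ [_ h2 h3]].
rewrite mulr0 mulr0 addr0 in h3.
have ad' : a^* * d' = 1.
  by rewrite -[d'](mxstarK star_inv) -mxstarM // h3 mxstar1.
have d'E : d' = a'^* by rewrite -[LHS]mul1r -aa's -mulrA ad' mulr1.
have skew_u : (a' * b)^* = - (e * (a' * b)).
  by rewrite mxstarM // -d'E h2 d'E mxstarK.
have SSLh : SSL (block_mx a 0 0 d').
  apply: SSL_diag; first by exists a'.
  by split=> //; rewrite d'E -mxstarM // aa' mxstar1.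
have -> : block_mx a b c d =
    block_mx 1 0 (c * a') 1 * block_mx a 0 0 d' * block_mx 1 (a' * b) 0 1
    :> 'M[B]_(m + m).
  rewrite !block_mulE !mul01E.
  by rewrite mulrA aa' mul1r -mulrA a'a mulr1 [c * (a' * b)]mulrA addrC /d' subrK.
by apply: (SSLM); [apply: SSLM|apply: SSL_upper].
Qed.

End Unitary.

(** * Making a corner invertible *)

Section Reduction.
Variables (B : nzRingType) (star : B -> B) (eps : B) (m : nat).
Hypotheses (star_inv : is_involution star) (eps_pm1 : eps = 1 \/ eps = -1).
Hypotheses (B_local : is_local B) (two_inv : invertible (2%:R : B)).

Local Notation "a ^*" := (mxstar star a) : ring_scope.
Local Notation "a ^r" := (map_mx (@res B) a) (at level 2, format "a ^r").
Local Notation A := 'M[B]_m.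
Local Notation SL := (SLstar star eps m).
Local Notation SSL := (SSLstar star eps m).
Implicit Types a b c d f r s t : A.

Let e : A := eps%:M.
Let signC := signC eps_pm1 : forall a, e * a = a * e.
Let signK := signK eps_pm1 : forall a, e * (e * a) = a.
Let sign_sqr := sign_sqr m eps_pm1 : e * e = 1.
Let star_sign := star_sign m star_inv eps_pm1 : e^* = e.

Lemma mxresM n (a b : 'M[B]_n) : (a * b)^r = a^r * b^r.
Proof. exact: (map_mxM (@res B)). Qed.
Lemma mxresD n (a b : 'M[B]_n) : (a + b)^r = a^r + b^r.
Proof. exact: (map_mxD (@res B)). Qed.
Lemma mxresB n (a b : 'M[B]_n) : (a - b)^r = a^r - b^r.
Proof. exact: (map_mxB (@res B)). Qed.
Lemma mxresN n (a : 'M[B]_n) : (- a)^r = - a^r.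
Proof. exact: (map_mxN (@res B)). Qed.
Lemma mxres1 n : (1 : 'M[B]_n)^r = 1.
Proof. exact: (map_mx1 (@res B)). Qed.
Lemma mxres_star a b : a^r = b^r -> a^*^r = b^*^r.
Proof.
move=> /matrixP ab; apply/matrixP => i j; rewrite !mxE.
by apply: res_star => //; have := ab j i; rewrite !mxE.
Qed.

Lemma half_exists : exists h : A,
  [/\ forall a, h * a = a * h, h^* = h & forall a, h * (a + a) = a].
Proof.
have [h [th ht]] := two_inv.
have thA : are_inverse (2%:R : A) (h%:M).
  by split; rewrite -(rmorph_nat (@scalar_mx B m)) -[_ * _]scalar_mxM ?th ?ht.
have [th1 ht1] := thA.
exists h%:M; split=> [a||a].
- rewrite -[LHS]mulr1 -th1 mulrA -[_ * a * _]mulrA mulr_natr -mulr_natl.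
  by rewrite [h%:M * _]mulrA ht1 mul1r.
- apply: (are_inverse_uniq (x := 2%:R)) => //; apply: are_inverseC.
  have := are_inverse_star star_inv thA.
  by rewrite mulr2n mxstarD // mxstar1.
- by rewrite -mulr2n -mulr_natl mulrA ht1 mul1r.
Qed.

(** Modulo the radical, c = f turns the unitarity relation into skewness of the
    f corner of a, and adding a skew multiple of c to a replaces that
    corner by s. *)
Lemma skew_shift a c f s :
    a^* * c = - (e * (c^* * a)) -> c^r = f^r -> f * f = f -> f^* = f ->
    s^* = - (e * s) -> s * f = s ->
  (f * a)^r = (f * a * f)^r /\
  exists2 r, r^* = - (e * r) & (a + r * c)^r = ((1 - f) * a + s)^r.
Proof.
move=> ac cf ff fstar skew_s sf.
have astarf : a^*^r * f^r = - (e^r * (f^r * a^r)).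
  have cstarf : c^*^r = f^r by rewrite (mxres_star cf) fstar.
  have := congr1 (fun x : A => x^r) ac.
  by rewrite mxresN !mxresM cstarf cf.
have ee : e^r * e^r = 1 by rewrite -mxresM sign_sqr mxres1.
have ffr : f^r * f^r = f^r by rewrite -mxresM ff.
have eC x : e^r * x^r = x^r * e^r by rewrite -!mxresM signC.
have fa : f^r * a^r = f^r * a^r * f^r.
  have : a^*^r * f^r * f^r = a^*^r * f^r by rewrite -mulrA ffr.
  rewrite astarf mulNr => /oppr_inj /(congr1 ( *%R e^r)).
  by rewrite -!mulrA !(mulrA e^r) ee !mul1r => <-.
split; first by rewrite !mxresM.
have [h [hC hstar h2]] := half_exists.
(* g is skew only modulo the radical; r0 is its skew part. *)
pose g := f * a * f; pose r0 := h * (g - e * g^*).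
have skew_r0 : r0^* = - (e * r0).
  rewrite /r0 mxstarM // hstar mxstarB // mxstarM // mxstarK // star_sign.
  rewrite -hC -(signC g) [e * (h * _)]mulrA [e * h]signC -mulrA [e * (_ - _)]mulrBr.
  by rewrite signK -[RHS]mulrN opprB.
exists (s - r0).
  by rewrite mxstarB // skew_s skew_r0 mulrBr opprB opprK addrC.
have gstar : g^*^r = - (e^r * (f^r * a^r)).
  rewrite /g !mxstarM // fstar !mxresM astarf mulrN [f^r * (e^r * _)]mulrA -eC -mulrA.
  by rewrite [f^r * (f^r * _)]mulrA ffr.
have -> : (a + (s - r0) * c)^r = a^r + (s^r - r0^r) * f^r.
  by rewrite mxresD mxresM mxresB cf.
have -> : r0^r = f^r * a^r * f^r.
  rewrite /r0 mxresM mxresB mxresM gstar mulrN opprK [e^r * (e^r * _)]mulrA ee mul1r.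
  have -> : g^r = f^r * a^r by rewrite !mxresM -fa.
  by rewrite -fa -mxresM -mxresD -mxresM h2.
rewrite mxresD mxresM mxresB mxres1 [_ * f^r]mulrBl -[s^r * _]mxresM sf.
by rewrite -!mulrA ffr !mulrA -fa mulrBl mul1r addrA addrAC.
Qed.

Lemma corner_invertible a a1 b c d f s s' :
    invertible (block_mx a b c d) -> c^r = f^r -> (f * a)^r = (f * a * f)^r ->
    f * f = f -> f * s = s -> s' * f = s' -> s' * s = f ->
    a1^r = ((1 - f) * a + s)^r ->
  invertible a1.
Proof.
move=> [y [_ yx]] cf fa ff fs s'f s's a1E.
pose y1 := (ulsubmx y)^r; pose y2 := (ursubmx y)^r.
have y12 : y1 * a^r + y2 * f^r = 1.
  have := congr1 (fun x : 'M[B]_(m + m) => (ulsubmx x)^r) yx.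
  rewrite -{1}[y]submxK block_mulE block_oneE !block_mxKul.
  by rewrite mxresD !mxresM cf mxres1.
apply: (left_inverse_mod_invertible B_local
  (y := y1 * (1 - f^r) + (y1 * f^r * a^r + y2) * s'^r)).
rewrite a1E mxresD mxresM mxresB mxres1.
have fa' : f^r * a^r = f^r * a^r * f^r by rewrite -!mxresM.
by apply: corner_left_inverse => //; rewrite -mxresM ?ff ?fs ?s'f ?s's.
Qed.

Lemma SSL_upper_cancel r a b c d : r^* = - (e * r) ->
  SSL (block_mx (a + r * c) (b + r * d) c d) -> SSL (block_mx a b c d).
Proof.
move=> skew_r SSLy.
have [_ SSLM _] := SSL_subgroup m star_inv eps_pm1.
have -> : block_mx a b c d = block_mx 1 (- r) 0 1 *
    block_mx (a + r * c) (b + r * d) c d :> 'M[B]_(m + m).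
  by rewrite block_mulE !mul01E !mulNr !addrK.
apply: SSLM => //; apply: SSL_upper => //.
by rewrite mxstarN // skew_r mulrN.
Qed.

Lemma SL_upper r a b c d : r^* = - (e * r) ->
  SL (block_mx a b c d) -> SL (block_mx (a + r * c) (b + r * d) c d).
Proof.
move=> skew_r SLx; have [_ SLM _] := SL_subgroup m star_inv eps_pm1.
have -> : block_mx (a + r * c) (b + r * d) c d =
    block_mx 1 r 0 1 * block_mx a b c d :> 'M[B]_(m + m).
  by rewrite block_mulE !mul01E.
apply: SLM => //; apply: (SSL_sub_SL star_inv eps_pm1).
exact: SSL_upper.
Qed.

Lemma SSL_of_skew_corner a b c d f s s' :
    SL (block_mx a b c d) -> c^r = f^r -> f * f = f -> f^* = f ->
    s^* = - (e * s) -> f * s = s -> s * f = s -> s' * f = s' -> s' * s = f ->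
  SSL (block_mx a b c d).
Proof.
move=> SLx cf ff fstar skew_s fs sf s'f s's.
have [inv_x [ac _ _]] := (SLstar_block star eps a b c d).1 SLx.
have [fa [r skew_r a1E]] := skew_shift ac cf ff fstar skew_s sf.
apply: (SSL_upper_cancel skew_r); apply: SSL_of_invertible_corner => //.
  exact: SL_upper.
exact: (corner_invertible inv_x cf fa ff fs s'f s's a1E).
Qed.

(** * Reduction to the Bruhat elements *)

Local Notation T := (Tmx B m).
Hypothesis m_gt0 : (1 <= m)%N.
Let el : A := proj m.-1 m.

Lemma TmxE : T = block_mx (1 - el) el el (1 - el).
Proof. by rewrite /Tmx e_last_proj. Qed.

Let el_idem : el * el = el := proj_idem _ _ _ _.
Let el_compl : el * (1 - el) = 0.
Proof. by rewrite mulrBr mulr1 el_idem subrr. Qed.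
Let compl_el : (1 - el) * el = 0.
Proof. by rewrite mulrBl mul1r el_idem subrr. Qed.
Let compl_idem : (1 - el) * (1 - el) = 1 - el.
Proof. by rewrite mulrBr mulr1 compl_el subr0. Qed.

Lemma Tmx_sqr : T * T = 1.
Proof.
rewrite TmxE block_mulE block_oneE compl_idem el_idem el_compl compl_el.
by rewrite !addr0 subrK [el + _]addrC subrK.
Qed.

Lemma SL_Tmx : eps = 1 -> SL T.
Proof.
move=> eps1; have e1 : e = 1 by rewrite /e eps1.
apply/SLstarP => //; split; first by exists T; split; apply: Tmx_sqr.
rewrite TmxE omegaE -/e e1 mxstar_block mxstarB // mxstar1 // mxstar_proj //.
rewrite !block_mulE !mul01E compl_idem el_idem el_compl compl_el.
by rewrite !addr0 subrK [el + _]addrC subrK.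
Qed.

(** T exchanges the last rows of a and c, and c = f modulo the radical: this puts
    a 1 in the coordinate that s leaves empty, so that s + el is invertible in
    the whole f corner. *)
Lemma SSL_Tmx_of_skew_corner a b c d f s s' : eps = 1 ->
    SL (block_mx a b c d) -> c^r = f^r -> f * f = f -> f^* = f ->
    s^* = - (e * s) -> f * s = s -> s * f = s -> s' * f = s' ->
    el * f = el -> f * el = el -> el * s = 0 -> s' * el = 0 -> s' * s = f - el ->
  exists2 g, SSL g & SSL (T * g * block_mx a b c d).
Proof.
move=> eps1 SLx cf ff fstar skew_s fs sf s'f ef fe es s'e s's.
have [inv_x [ac _ _]] := (SLstar_block star eps a b c d).1 SLx.
have [fa [r skew_r a1E]] := skew_shift ac cf ff fstar skew_s sf.
have [_ SLM _] := SL_subgroup m star_inv eps_pm1.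
exists (block_mx 1 r 0 1); first exact: SSL_upper.
have SLy : SL (T * block_mx 1 r 0 1 * block_mx a b c d).
  apply: (SLM) SLx; apply: SLM; first exact: SL_Tmx.
  by apply: (SSL_sub_SL star_inv eps_pm1); apply: SSL_upper.
move: SLy; rewrite -mulrA TmxE block_mulE !mul01E block_mulE => SLy.
apply: SSL_of_invertible_corner => //.
apply: (corner_invertible (s := s + el) (s' := s' + el) inv_x cf fa ff).
- by rewrite mulrDr fs fe.
- by rewrite mulrDl s'f ef.
- by rewrite mulrDl !mulrDr s's s'e es el_idem addr0 add0r subrK.
have efbar : el^r * f^r = el^r by rewrite -mxresM ef.
rewrite mxresD !mxresM cf efbar a1E -mxresM -mxresD; congr map_mx.
have e1f : (1 - el) * (1 - f) = 1 - f.
  by rewrite mulrBl mul1r mulrBr mulr1 ef subrr subr0.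
by rewrite mulrDr mulrA e1f [_ * s]mulrBl mul1r es subr0 addrA.
Qed.

(** The lower left block of omega T is 1 - e, of even rank m - 1, so there is an
    alternating matrix s invertible in its corner. *)
Lemma SSL_Tmx_odd : eps = 1 -> odd m -> SSL T.
Proof.
move=> eps1 odd_m.
have e1 : e = 1 by rewrite /e eps1.
pose s : A := antidiag 0 m.-1.
have even_m : ~~ odd (0 + m.-1) by move: odd_m; rewrite -{1}(prednK m_gt0).
have es : el * s = 0 by rewrite -[s]proj_antidiag mulrA proj_disjointC mul0r.
have se : s * el = 0 by rewrite -[s]antidiag_proj -mulrA proj_disjoint mulr0.
have ss : s * s = el - 1.
  rewrite antidiag_sqr ?leq_pred // -(proj_full B m).
  by rewrite -(@proj_cat B m 0 m.-1 m) ?leq_pred // opprD addrCA subrr addr0.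
have skew_s : s^* = - (e * s) by rewrite mxstar_antidiag // e1 mul1r.
have wT : omega eps m * T = block_mx el (1 - el) (1 - el) el.
  by rewrite omegaE -/e e1 TmxE block_mulE !mul01E.
have [_ SLM _] := SL_subgroup m star_inv eps_pm1.
have SLw := SL_omega m star_inv eps_pm1.
have SL_wT : SL (omega eps m * T) by apply: SLM => //; apply: SL_Tmx.
have SSL_wT : SSL (omega eps m * T).
  rewrite wT in SL_wT *; apply: (SSL_upper_cancel skew_s).
  apply: SSL_of_invertible_corner => //; first exact: SL_upper.
  exists (el - s); rewrite mulrBr mulr1 se subr0.
  split; first by rewrite mulrDl !mulrBr el_idem es se ss !subr0 sub0r opprB addrC subrK.
  by rewrite mulrBl !mulrDr el_idem es se ss addr0 add0r opprB addrC subrK.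
have SSLw : SSL (omega eps m) by apply: SSL_omega.
have [inv_w _] := (SLstarP star_inv eps_pm1 _).1 SLw.
have inv1 : invertible (1 : 'M[B]_(m + m)) by exists 1; apply: are_inverse1.
have sgS := SSL_subgroup m star_inv eps_pm1; have [S1 _ _] := sgS.
by apply: (subgroup_cancel sgS inv_w inv1 SSLw S1); rewrite mulr1.
Qed.

(** The elements h_t multiply the lower left block by t on the right and by the
    inverse of t^* on the left, so all of elimination is available. *)
Lemma SL_normal_form x : SL x -> exists g h l,
  [/\ SSL g, SSL h, (l <= m)%N & (dlsubmx (g * x * h))^r = proj l m].
Proof.
move=> SLx.
have [p [q [l [inv_p [q' qq'] le_lm pcq]]]] :=
  rank_normal_form_last B_local (dlsubmx x).
have [p' pp'] := inv_p.
exists (block_mx p'^* 0 0 p), (block_mx q 0 0 q'^*), l; split=> //.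
- apply: SSL_diag; first by exists p^*; apply: are_inverse_star.
  by rewrite mxstarK //; apply: are_inverseC.
- apply: SSL_diag; first by exists q'.
  exact/are_inverseC/are_inverse_star.
by rewrite -[x]submxK !block_mulE !mul01E block_mxKdl -pcq.
Qed.

(** A skew element invertible in a corner of size m - l exists, except for an
    alternating form (eps = 1 and trivial residual involution) in odd size; the
    last coordinate is then left over, and T deals with it. *)
Lemma SSL_or_Tmx x : SL x -> SSL x \/
  [/\ eps = 1, ramified star & exists g h, [/\ SSL g, SSL h & SSL (T * g * x * h)]].
Proof.
move=> SLx; have [g [h [l [SSLg SSLh le_lm clm]]]] := SL_normal_form SLx.
have sgS := SSL_subgroup m star_inv eps_pm1.
have [_ SLM _] := SL_subgroup m star_inv eps_pm1.
have SLg := SSL_sub_SL star_inv eps_pm1 SSLg.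
have SLh := SSL_sub_SL star_inv eps_pm1 SSLh.
have [inv_g _] := (SLstarP star_inv eps_pm1 _).1 SLg.
have [inv_h _] := (SLstarP star_inv eps_pm1 _).1 SLh.
have SLy : SL (g * x * h) by apply: (SLM) SLh; apply: SLM.
pose f : A := proj l m.
have ff : f * f = f := proj_idem _ _ _ _.
have fstar : f^* = f := mxstar_proj star_inv _ _ _.
have skew_corner s s' : s^* = - (e * s) -> f * s = s -> s * f = s ->
    s' * f = s' -> s' * s = f -> SSL x.
  move=> skew_s fs sf s'f s's; apply: (subgroup_cancel sgS inv_g inv_h) => //.
  rewrite -[g * x * h]submxK in SLy *.
  apply: (SSL_of_skew_corner SLy _ ff fstar skew_s fs sf s'f s's).
  by rewrite clm map_proj.
have [eps1|epsN1] := eps_pm1; last first.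
  left; apply: (skew_corner f f) => //.
  by rewrite fstar /e epsN1 (rmorphN (@scalar_mx B m)) mulN1r opprK.
have e1 : e = 1 by rewrite /e eps1.
have [ram|/existsNP[b /eqP nram]] := pselect (ramified star); last first.
  have [z [bz zb]] : invertible (b - star b).
    by apply/(invertible_resP B_local)/eqP; rewrite rmorphB subr_eq0 eq_sym.
  have fC (y : B) : f * y%:M = y%:M * f.
    rewrite -!mulmxE; apply/matrixP => i j.
    rewrite mul_diag_mx mul_mx_diag !mxE.
    have [<-|_] := eqVneq i j; last by rewrite mul0r mulr0.
    exact/esym/commr_nat.
  left; apply: (skew_corner ((b - star b)%:M * f) (z%:M * f)).
  - rewrite mxstarM // fstar mxstar_scalar // starD // starN // starK //.
    by rewrite fC e1 mul1r -mulNr -(rmorphN (@scalar_mx B m)) opprB addrC.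
  - by rewrite mulrA fC -mulrA ff.
  - by rewrite -mulrA ff.
  - by rewrite -mulrA ff.
  rewrite mulrA -[z%:M * f * _]mulrA fC mulrA -!mulrA ff mulrA.
  by rewrite -[_ * _%:M]scalar_mxM zb mul1r.
have skew_antidiag u : ~~ odd (l + u) ->
    (antidiag l u : A)^* = - (e * antidiag l u).
  by move=> even_lu; rewrite mxstar_antidiag // e1 mul1r.
have [odd_lm|even_lm] := boolP (odd (l + m)); last first.
  left; apply: (skew_corner (antidiag l m) (- antidiag l m)).
  - exact: skew_antidiag.
  - exact: proj_antidiag.
  - exact: antidiag_proj.
  - by rewrite mulNr antidiag_proj.
  - by rewrite mulNr antidiag_sqr ?opprK.
right; split=> //.
have lt_lm : (l < m)%N.
  rewrite ltn_neqAle le_lm andbT; apply/eqP => lm.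
  by move: odd_lm; rewrite lm addnn odd_double.
have even_lm : ~~ odd (l + m.-1) by move: odd_lm; rewrite -{1}(prednK m_gt0) addnS.
have f_split : f = proj l m.-1 + el by rewrite proj_cat //; lia.
pose s : A := antidiag l m.-1.
have es : el * s = 0 by rewrite -[s]proj_antidiag mulrA proj_disjointC mul0r.
have se : s * el = 0 by rewrite -[s]antidiag_proj -mulrA proj_disjoint mulr0.
have fs : f * s = s by rewrite f_split mulrDl es proj_antidiag addr0.
have sf : s * f = s by rewrite f_split mulrDr se antidiag_proj addr0.
have ef : el * f = el by rewrite f_split mulrDr proj_disjointC proj_idem add0r.
have fe : f * el = el by rewrite f_split mulrDl proj_disjoint proj_idem add0r.
rewrite -[g * x * h]submxK in SLy.
have [u SSLu] : exists2 u, SSL u & SSL (T * u * (g * x * h)).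
  rewrite -[g * x * h]submxK.
  apply: (@SSL_Tmx_of_skew_corner _ _ _ _ f s (- s)) => //.
  - by rewrite clm map_proj.
  - exact: skew_antidiag.
  - by rewrite mulNr sf.
  - by rewrite mulNr se oppr0.
  - by rewrite mulNr antidiag_sqr ?opprK ?f_split ?addrK //; lia.
move=> SSLy; exists (u * g), h; split=> //; last by rewrite !mulrA in SSLy *.
by have [_ SSLM _] := sgS; apply: SSLM.
Qed.

End Reduction.
(** * Determinants modulo the radical *)

Section Determinants.
Variable R : comPzRingType.

Lemma det_hyperbolic_swap m :
  \det (block_mx 0 1%:M 1%:M 0 : 'M[R]_(m + m)) = (-1) ^+ m.
Proof.
pose u : 'M[R]_(m + m) := block_mx 1%:M 1%:M 0 1%:M.
pose l : 'M[R]_(m + m) := block_mx 1%:M 0 (- 1%:M) 1%:M.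
pose d : 'M[R]_(m + m) := block_mx (- 1%:M) 0 0 1%:M.
have -> : block_mx 0 1%:M 1%:M 0 = u *m l *m u *m d.
  rewrite /u /l /d !mulmx_block !(mul0mx, mulmx0, mul1mx, mulmx1, addr0, add0r).
  by rewrite mulNmx mul1mx subrr addNr opprK !(mul0mx, addr0, add0r).
have -> : \det (u *m l *m u *m d) = \det d.
  by rewrite !det_mulmx [\det u]det_ublock [\det l]det_lblock !det1 !mul1r.
by rewrite det_ublock det1 mulr1 -(rmorphN1 (@scalar_mx R m)) det_scalar.
Qed.

Lemma det_hyperbolic_reflection m (e : 'M[R]_m) : e *m e = e ->
  \det (block_mx (1%:M - e) e e (1%:M - e)) = \det (1%:M - e *+ 2).
Proof.
move=> ee.
pose u : 'M[R]_(m + m) := block_mx 1%:M 1%:M 0 1%:M.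
pose u' : 'M[R]_(m + m) := block_mx 1%:M (- 1%:M) 0 1%:M.
have det_u : \det u = 1 by rewrite det_ublock !det1 mulr1.
have det_u' : \det u' = 1 by rewrite det_ublock !det1 mulr1.
transitivity (\det (u *m block_mx (1%:M - e) e e (1%:M - e) *m u')).
  by rewrite !det_mulmx det_u det_u' mul1r mulr1.
rewrite /u /u' !mulmx_block !(mul0mx, mulmx0, mul1mx, mulmx1, addr0, add0r).
rewrite subrK [e + _]addrC subrK mulmxN mulmx1 addNr.
by rewrite det_lblock det1 mul1r mulmxN mulmx1 addrC -addrA -opprD.
Qed.

Lemma det_last_reflection m : (1 <= m)%N ->
  \det (1%:M - (proj m.-1 m : 'M[R]_m) *+ 2) = -1.
Proof.
move=> m_gt0; pose i0 : 'I_m := Ordinal (eq_leq (prednK m_gt0)).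
have -> : 1%:M - (proj m.-1 m : 'M[R]_m) *+ 2 =
    diag_mx (\row_i (if i == i0 then -1 else 1)).
  apply/matrixP => i j; rewrite !mxE.
  have [_|_] := eqVneq i j; last by rewrite !mulr0n addr0 subr0.
  rewrite !mulr1n -val_eqE /=; have lti := ltn_ord i.
  have -> : (m.-1 <= i < m)%N = (i == m.-1 :> nat) by lia.
  by case: eqP => _; rewrite ?addr0 ?subr0 // opprD addrA subrr sub0r.
rewrite det_diag (bigD1 i0) //= mxE eqxx big1 ?mulr1 // => i /negPf ii0.
by rewrite mxE ii0.
Qed.

End Determinants.

Section Ramified.
Variables (B : nzRingType) (star : B -> B) (m : nat).
Hypotheses (star_inv : is_involution star) (B_local : is_local B).
Hypotheses (two_inv : invertible (2%:R : B)) (m_gt0 : (1 <= m)%N).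
Hypotheses (ram : ramified star) (even_m : ~~ odd m).

Local Notation "a ^*" := (mxstar star a) : ring_scope.
Local Notation "a ^r" := (map_mx (@res B) a) (at level 2, format "a ^r").
Local Notation SL := (SLstar star 1 m).
Local Notation SSL := (SSLstar star 1 m).
Local Notation T := (Tmx B m).
Let one_pm1 : (1 : B) = 1 \/ (1 : B) = -1. Proof. by left. Qed.

(** An antiautomorphism that is the identity forces commutativity. *)
Lemma residue_mulC : commutative (@GRing.mul (residue B)).
Proof.
move=> x y; rewrite -[x]res_repr -[y]res_repr -!rmorphM /=.
by rewrite -ram starM // !rmorphM /= !ram.
Qed.

(** The same ring, with the commutativity that the determinant requires. *)
Let F : comPzRingType :=
  HB.pack (residue B) (GRing.PzRing_hasCommutativeMul.Build _ residue_mulC).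

Let detO (x : 'M[B]_(m + m)) : residue B := \det (Omega x).

Let detOM x y : detO (x * y) = detO x * detO y.
Proof. by rewrite /detO /Omega mxresM; apply: (@det_mulmx F). Qed.

Let detO1 : detO 1 = 1.
Proof. by rewrite /detO /Omega mxres1; apply: (@det1 F). Qed.

Let detO_inverse x y : are_inverse x y -> detO x * detO y = 1.
Proof. by move=> [xy _]; rewrite -detOM xy. Qed.

Lemma mxres_star_ramified n (a : 'M[B]_n) : a^*^r = a^r^T.
Proof. by apply/matrixP => i j; rewrite !mxE ram. Qed.

Lemma Ogrp_Omega x : SL x -> Ogrp (residue B) m (Omega x).
Proof.
move=> /(SLstarP star_inv one_pm1)[inv_x xx].
split; first exact: invertible_map.
have := congr1 (fun x : 'M[B]_(m + m) => x^r) xx.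
rewrite !mxresM mxres_star_ramified /omega map_block_mx.
by rewrite !(map_mx0 (@res B)) !(map_mx1 (@res B)).
Qed.

Lemma detO_SSL x : SSL x -> detO x = 1.
Proof.
pose G := SL `&` [set x | detO x = 1].
have [SL1 SLM SLV] := SL_subgroup m star_inv one_pm1.
have sgG : is_subgroup G.
  split=> [|y z [SLy y1] [SLz z1]|y [SLy y1]].
  - by split=> //; exact: detO1.
  - by split; [apply: SLM|rewrite /= detOM y1 z1 mulr1].
  have [z SLz yz] := SLV _ SLy; exists z => //; split=> //=.
  by rewrite -[LHS]mul1r -y1 detO_inverse.
suff sub : SSL `<=` G by move=> /sub[].
apply: smallest_sub => // y Sy; split.
  exact: (bruhat_sub_SL star_inv one_pm1).
case: Sy => [->|[t [s [_ [ts _] ->]]]|[r _ ->]] /=.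
- rewrite /detO /Omega map_block_mx !(map_mx0 (@res B)) !(map_mx1 (@res B)).
  apply: etrans (@det_hyperbolic_swap F m) _.
  by rewrite -signr_odd (negPf even_m) expr0.
- rewrite /detO /Omega map_block_mx !(map_mx0 (@res B)).
  apply: etrans (@det_ublock F _ _ _ _ _) _.
  rewrite -[X in X * _](@det_tr F) -[RHS](@det1 F m) -(@det_mulmx F).
  by rewrite -mxres_star_ramified; congr (\det _);
    transitivity ((t^* * s)^r); [rewrite mxresM|rewrite ts mxres1].
- rewrite /detO /Omega map_block_mx !(map_mx0 (@res B)) !(map_mx1 (@res B)).
  apply: etrans (@det_ublock F _ _ _ _ _) _.
  by rewrite !(@det1 F) mulr1.
Qed.

Lemma detO_Tmx : detO T = -1.
Proof.
rewrite /detO /Omega TmxE // map_block_mx !mxresB !mxres1 map_proj.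
apply: etrans (@det_hyperbolic_reflection F m _ _) _.
  exact: proj_idem.
exact: det_last_reflection.
Qed.

Lemma oneN1_residue : -1 != 1 :> residue B.
Proof.
rewrite eq_sym -subr_eq0 opprK -(rmorph1 (@res B)) -rmorphD.
by apply/eqP/(invertible_resP B_local).
Qed.

(** Otherwise some T g x h with g and h in SSL would be in SSL, and x would have
    determinant -1, like T. *)
Lemma SSL_detO x : SL x -> detO x = 1 -> SSL x.
Proof.
move=> SLx x1.
have [//|[_ _ [g [h [SSLg SSLh /detO_SSL]]]]] :=
  SSL_or_Tmx star_inv one_pm1 B_local two_inv m_gt0 SLx.
rewrite !detOM detO_Tmx (detO_SSL SSLg) (detO_SSL SSLh) x1 !mulr1 => /eqP.
by rewrite (negPf oneN1_residue).
Qed.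

Lemma SSL_eq_SO :
  SSL = SL `&` [set x | SOgrp (residue B) m (Omega x)].
Proof.
apply/seteqP; split=> [x SSLx|x [SLx [_ x1]]]; last exact: SSL_detO.
have SLx := SSL_sub_SL star_inv one_pm1 SSLx.
by split=> //; split; [apply: Ogrp_Omega|apply: detO_SSL].
Qed.

Lemma SL_sdprod : internal_sdprod SL SSL (generated [set T]).
Proof.
have sgL := SL_subgroup m star_inv one_pm1; have [SL1 SLM SLV] := sgL.
have sgS := SSL_subgroup m star_inv one_pm1; have [SSL1 _ _] := sgS.
have SLT : SL T by apply: SL_Tmx.
have TT := Tmx_sqr B m_gt0.
have sTL : [set T] `<=` SL by move=> _ ->.
have sgT := generated_subgroup sgL sTL.
split=> //.
- by split; [apply: SSL_sub_SL|apply: smallest_sub].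
- move=> x y n SLx xy SSLn; have SLy := subgroupV sgL SLx xy.
  apply: SSL_detO.
    by apply: (SLM) SLy; apply: SLM => //; apply: (SSL_sub_SL star_inv).
  by rewrite !detOM [detO n]detO_SSL // mulr1 detO_inverse.
- rewrite generated_involution //; apply/seteqP; split=> [x SLx|]; last first.
    move=> _ [n [h [/(SSL_sub_SL star_inv one_pm1) SLn Th ->]]].
    by apply: SLM => //; case: Th => ->.
  have [SSLx|[_ _ [g [h [SSLg SSLh /detO_SSL]]]]] :=
    SSL_or_Tmx star_inv one_pm1 B_local two_inv m_gt0 SLx.
    by exists x, 1; split=> //; [left|rewrite mulr1].
  rewrite !detOM detO_Tmx (detO_SSL SSLg) (detO_SSL SSLh) !mulr1 => xT.
  exists (x * T), T; split; [|by right|by rewrite -mulrA TT mulr1].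
  apply: SSL_detO; first exact: SLM.
  by rewrite detOM detO_Tmx mulrN1 -[RHS]xT mulN1r.
rewrite generated_involution //; apply/seteqP; split=> [x [SSLx [//|xT]]|_ ->].
  have /eqP := detO_SSL SSLx.
  by rewrite xT detO_Tmx (negPf oneN1_residue).
by split=> //; left.
Qed.

End Ramified.

Theorem theorem4p4 (B : unitRingType) (star : B -> B) (eps : B) (m : nat)
    (B_local : is_local B)
    (two_unit : (2%:R : B) \is a GRing.unit)
    (star_inv : is_involution star)
    (m_ge1 : (1 <= m)%N)
    (eps_pm1 : eps = 1 \/ eps = -1) :
  (~ [/\ eps = 1, ramified star & ~~ odd m] ->
     SLstar star eps m = SSLstar star eps m) /\
  ([/\ eps = 1, ramified star & ~~ odd m] ->
     internal_sdprod (SLstar star eps m) (SSLstar star eps m)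
       (generated [set Tmx B m]) /\
     SSLstar star eps m =
       SLstar star eps m `&` [set x | SOgrp (residue B) m (Omega x)]).
Proof.
have two_inv : invertible (2%:R : B).
  by exists (2%:R)^-1; split; rewrite ?divrr ?mulVr.
split=> [generic|[eps1 ram even_m]]; last first.
  by subst eps; split; [apply: SL_sdprod|apply: SSL_eq_SO].
have sgS := SSL_subgroup m star_inv eps_pm1.
apply/seteqP; split=> x; last exact: SSL_sub_SL.
move=> /(SSL_or_Tmx star_inv eps_pm1 B_local two_inv m_ge1).
case=> [//|[eps1 ram [g [h [SSLg SSLh SSLy]]]]].
have odd_m : odd m by apply/negPn/negP => even_m; apply: generic.
have SSLT := SSL_Tmx_odd star_inv eps_pm1 m_ge1 eps1 odd_m.
have inv y : SSLstar star eps m y -> invertible y.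
  by move=> /(SSL_sub_SL star_inv eps_pm1)[].
have [_ SSLM _] := sgS; have SSLTg := SSLM _ _ SSLT SSLg.
exact: (subgroup_cancel sgS (inv _ SSLTg) (inv _ SSLh)).
Qed.
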